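(* Let $N=\{1,\dots,n\}$ be a nonempty finite set of agents and let $\mathcal{IS}^N$ be the family of interval inventory situations with agent set $N$ described in the context. There exists a unique interval allocation rule $\Psi$ on $\mathcal{IS}^N$ satisfying both Inactive Agent Exemption (IAE) and Transfer-Based Additivity (TBA). It is the interval SOC-rule $\Gamma$, given by $$\Gamma_j(N,a,\{m_i\}_{i\in N})=\frac{2a\,m_j^2}{\sqrt{\sum_{i\in N}m_i^2}}\qquad (j\in N).$$
   Context: A closed interval of reals is written $b=[\underline b,\overline b]$ with $\underline b\le\overline b$; $\mathcal I(\mathbb R)$ is the set of all of them. Interval arithmetic is endpointwise: $b+c=[\underline b+\underline c,\overline b+\overline c]$, $b\cdot c=[\underline b\,\underline c,\overline b\,\overline c]$ (so $b^2=[\underline b^2,\overline b^2]$ for intervals of nonnegative reals), $\sqrt b=[\sqrt{\underline b},\sqrt{\overline b}]$ for intervals of nonnegative reals, $\beta b=[\beta\underline b,\beta\overline b]$ for $\beta\ge0$. The quotient of intervals of nonnegative reals is $\frac{b}{c}=\left[\frac{\underline b}{\underline c},\frac{\overline b}{\overline c}\right]$, defined only if $\underline c,\overline c\neq0$ and $\underline b\,\overline c\le\overline b\,\underline c$. Equalities between expressions in intervals mean equality of lower endpoints and equality of upper endpoints. An interval inventory situation is a triple $(N,a,\{m_i\}_{i\in N})$ with $a>0$ a real number (the fixed ordering cost) and each $m_i=[\underline{m_i},\overline{m_i}]$ a closed interval of nonnegative reals. Put $m_N=\sqrt{\sum_{i\in N}m_i^2}$, i.e. $\underline{m_N}=\sqrt{\sum_{i\in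 N}\underline{m_i}^2}$ and $\overline{m_N}=\sqrt{\sum_{i\in N}\overline{m_i}^2}$. The family $\mathcal{IS}^N$ consists of the situations with agent set $N$, with $\underline{m_N}>0$ and $$\underline{m_i}^2\;\overline{m_N}\le\overline{m_i}^2\;\underline{m_N}\quad\text{for all } i\in N,$$ which is exactly the condition for the quotient defining $\Gamma$ to be defined for every agent. An interval allocation rule is a map $\Psi:\mathcal{IS}^N\to\mathcal I(\mathbb R)^N$ such that $\sum_{i\in N}\Psi_i(N,a,\{m_l\}_{l\in N})=2a\sqrt{\sum_{i\in N}m_i^2}$ for every situation in $\mathcal{IS}^N$. IAE: for all $(N,a,\{m_i\}_{i\in N})\in\mathcal{IS}^N$ and all $j\in N$ with $m_j=[0,0]$, $\Psi_j(N,a,\{m_i\}_{i\in N})=[0,0]$. TBA: for all $(N,a,\{m_i\}_{i\in N})$ and $(N,a,\{\hat m_i\}_{i\in N})$ in $\mathcal{IS}^N$ (same $a$) such that $\left(N,a,\left\{\sqrt{m_i^2+\hat m_i^2}\right\}_{i\in N}\right)$ is also in $\mathcal{IS}^N$, and all $j\in N$, $$\sqrt{\sum_{i\in N}(m_i^2+\hat m_i^2)}\cdot\Psi_j\left(N,a,\left\{\sqrt{m_i^2+\hat m_i^2}\right\}_{i\in N}\right)=\sqrt{\sum_{i\in N}m_i^2}\cdot\Psi_j(N,a,\{m_i\}_{i\in N})+\sqrt{\sum_{i\in N}\hat m_i^2}\cdot\Psi_j(N,a,\{\hat m_i\}_{i\in N}).$$ *)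

(* Defs.v *)
From HB Require Import structures.
From mathcomp Require Import all_boot all_order all_algebra.
From mathcomp Require Import reals.

Set Implicit Arguments.
Unset Strict Implicit.
Unset Printing Implicit Defensive.

Import Order.TTheory GRing.Theory Num.Theory.
Local Open Scope ring_scope.

Record citv (R : realType) := CItv {
  lo : R;
  hi : R;
  lo_le_hi : lo <= hi }.

(* Interval expressions are evaluated on endpoint pairs in R * R, whose ring
   operations are componentwise.  A value of an expression need not be an
   interval: [1, 2] * [-4, -3] has the endpoint pair (-4, -6). *)
Definition endpoints (R : realType) (b : citv R) : R * R := (lo b, hi b).

Definition isqrt (R : realType) (b : R * R) : R * R :=
  (Num.sqrt b.1, Num.sqrt b.2).

Definition iscale (R : realType) (beta : R) (b : R * R) : R * R :=
  (beta * b.1, beta * b.2).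

Definition quotient_defined (R : realType) (b c : R * R) : bool :=
  [&& c.1 != 0, c.2 != 0 & b.1 * c.2 <= b.2 * c.1].

Lemma quotient_le (R : realType) (b c : R * R) :
  0 <= c.1 -> 0 <= c.2 -> quotient_defined b c -> b.1 / c.1 <= b.2 / c.2.
Proof.
move=> c1 c2 /and3P[n1 n2 h].
have p1 : 0 < c.1 by rewrite lt_def n1 c1.
have p2 : 0 < c.2 by rewrite lt_def n2 c2.
by rewrite ler_pdivrMr // mulrAC ler_pdivlMr.
Qed.

(* [orders s i] is the interval m_i. *)
Record situation (R : realType) (n : nat) := Situation {
  cost : R;
  orders : 'I_n -> citv R;
  cost_gt0 : 0 < cost;
  orders_ge0 : forall i, 0 <= lo (orders i) }.

(* The endpoint pair of m_i. *)
Definition m_ (R : realType) (n : nat) (s : situation R n) (i : 'I_n) : R * R :=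
  endpoints (orders s i).

Definition mN (R : realType) (n : nat) (s : situation R n) : R * R :=
  isqrt (\sum_(i < n) m_ s i ^+ 2).

Record IS (R : realType) (n : nat) := MkIS {
  IS_situation :> situation R n;
  mN_gt0 : 0 < (mN IS_situation).1;
  IS_le : forall i : 'I_n,
    (m_ IS_situation i).1 ^+ 2 * (mN IS_situation).2
      <= (m_ IS_situation i).2 ^+ 2 * (mN IS_situation).1 }.

Definition is_allocation_rule (R : realType) (n : nat)
    (Psi : IS R n -> 'I_n -> citv R) : Prop :=
  forall s : IS R n,
    \sum_(i < n) endpoints (Psi s i)
      = iscale (2 * cost s) (isqrt (\sum_(i < n) m_ s i ^+ 2)).

Definition IAE (R : realType) (n : nat)
    (Psi : IS R n -> 'I_n -> citv R) : Prop :=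
  forall (s : IS R n) (j : 'I_n),
    m_ s j = (0, 0) -> endpoints (Psi s j) = (0, 0).

(* [t] is the situation with the same cost and the intervals
   sqrt (m_i ^ 2 + m'_i ^ 2), assumed to belong to the family. *)
Definition TBA (R : realType) (n : nat)
    (Psi : IS R n -> 'I_n -> citv R) : Prop :=
  forall s s' t : IS R n,
    cost s' = cost s -> cost t = cost s ->
    (forall i : 'I_n, m_ t i = isqrt (m_ s i ^+ 2 + m_ s' i ^+ 2)) ->
    forall j : 'I_n,
      isqrt (\sum_(i < n) (m_ s i ^+ 2 + m_ s' i ^+ 2)) * endpoints (Psi t j)
      = isqrt (\sum_(i < n) m_ s i ^+ 2) * endpoints (Psi s j)
        + isqrt (\sum_(i < n) m_ s' i ^+ 2) * endpoints (Psi s' j).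

Lemma mN2_gt0 (R : realType) (n : nat) (s : IS R n) : 0 < (mN s).2.
Proof.
apply: (lt_le_trans (mN_gt0 s)); rewrite /mN /isqrt /= ler_wsqrtr //.
rewrite (raddf_sum (@fst R R)) (raddf_sum (@snd R R)) /=.
apply: ler_sum => i _.
have h0 := orders_ge0 s i; have h := lo_le_hi (orders s i).
by apply: ler_pM.
Qed.

Lemma SOC_quotient_defined (R : realType) (n : nat) (s : IS R n) (j : 'I_n) :
  quotient_defined (iscale (2 * cost s) (m_ s j ^+ 2)) (mN s).
Proof.
rewrite /quotient_defined !gt_eqF ?mN_gt0 ?mN2_gt0 //= -!mulrA.
rewrite !ler_pM2l ?cost_gt0 ?ltr0n // !mulrA.
exact: IS_le.
Qed.

(* The endpoints are those of (2 a m_j ^ 2) / m_N. *)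
Definition SOC (R : realType) (n : nat) (s : IS R n) (j : 'I_n) : citv R :=
  @CItv R
    ((iscale (2 * cost s) (m_ s j ^+ 2)).1 / (mN s).1)
    ((iscale (2 * cost s) (m_ s j ^+ 2)).2 / (mN s).2)
    (quotient_le (ltW (mN_gt0 s)) (ltW (mN2_gt0 s)) (SOC_quotient_defined s j)).

(* Main.v *)
Require Import Defs.
From mathcomp Require Import all_boot all_order all_algebra.
From mathcomp Require Import reals.
From mathcomp Require Import boolp lra.

Set Implicit Arguments.
Unset Strict Implicit.
Unset Printing Implicit Defensive.

Import Order.TTheory GRing.Theory Num.Theory.
Local Open Scope ring_scope.

(** Everything is linear in the right coordinates.  Describe a situation by the
    squares [m_i ^+ 2 = (x_i, y_i)], and a rule by the products
    [m_N * Psi_j].  TBA then says that these products are additive in the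
    squares, being an allocation rule says that they sum to [2 a \sum_i m_i ^+ 2],
    and the SOC-rule is the one whose products are [2 a m_j ^+ 2], which makes
    its three properties immediate ([SOC_rule]).

    For uniqueness the natural move is to split a situation into agent [j]
    alone, where IAE and the allocation property determine the product, and the
    other agents, where IAE gives agent [j] nothing.  The obstruction is that
    the parts need not belong to the family: for instance an agent with
    [x_i = 0 < y_i] cannot stand alone.  Membership reads
    [x_i * sqrt Y <= y_i * sqrt X], with [X] and [Y] the sums of the [x_i] and
    of the [y_i].  It holds as soon as all ratios [y_i / x_i] lie
    in some [[q, q ^ 2]], since then [sqrt (Y / X) <= q <= y_i / x_i].  With
    [q = 2] this is the class of narrow situations, which is stable under
    restriction to any set of agents that are not all inactive, so the split
    is legitimate there ([weighted_narrow]).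

    A general situation [s] is the difference of two narrow ones: adding
    squares [(L, 3 L)] to every agent, for large [L], moves all ratios close to
    [3], inside [[2, 4]].  Additivity for [t = s + u] with [u] and [t] narrow
    determines the products at [s] ([weighted_unique]), and these determine the
    rule because both endpoints of [m_N] are positive. *)

(** * Endpoint pairs *)

Section Endpoints.
Variable R : realType.
Implicit Types (b : R * R) (beta : R).

Lemma sum_pair (I : finType) (x y : I -> R) :
  \sum_i (x i, y i) = (\sum_i x i, \sum_i y i).
Proof.
rewrite [LHS]surjective_pairing.
by rewrite (raddf_sum (@fst R R)) (raddf_sum (@snd R R)).
Qed.

Lemma isqrtK b : 0 <= b.1 -> 0 <= b.2 -> isqrt b ^+ 2 = b.
Proof.
case: b => b1 b2 /= h1 h2.
by congr pair; rewrite -[RHS]sqr_sqrtr // expr2.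
Qed.

Lemma sqr_isqrt b : 0 <= b.1 -> 0 <= b.2 -> isqrt (b ^+ 2) = b.
Proof.
case: b => b1 b2 /= h1 h2.
by rewrite /isqrt; congr pair; rewrite [LHS]sqrtr_sqr ger0_norm.
Qed.

Lemma iscaleE beta b : iscale beta b = (beta, beta) * b.
Proof. by []. Qed.

Lemma endpoints_inj : injective (@endpoints R).
Proof.
move=> [l h lh] [l' h' lh'] [] /= el eh; subst l' h'.
by congr CItv; exact: bool_irrelevance.
Qed.

End Endpoints.

(** * Situations in squared coordinates *)

Section Situations.
Variables (R : realType) (n : nat).
Implicit Types (s t : IS R n) (x y : 'I_n -> R) (j : 'I_n).
Implicit Types (Psi : IS R n -> 'I_n -> citv R).

Lemma m_sqr_bounds s i : 0 <= (m_ s i ^+ 2).1 <= (m_ s i ^+ 2).2.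
Proof.
have h0 := orders_ge0 s i; have h := lo_le_hi (orders s i).
by rewrite mulr_ge0 //= ler_pM.
Qed.

Lemma mN_sqr s : mN s ^+ 2 = \sum_i m_ s i ^+ 2.
Proof.
by apply: isqrtK; rewrite (raddf_sum (@fst R R), raddf_sum (@snd R R));
   apply: sumr_ge0 => i _; have /andP[h0 h] := m_sqr_bounds s i;
   rewrite ?(le_trans h0).
Qed.

Lemma mN_sqr_fst s : (mN s ^+ 2).1 = \sum_i (m_ s i ^+ 2).1.
Proof. by rewrite mN_sqr (raddf_sum (@fst R R)). Qed.

Lemma sum_lo_gt0 s : 0 < \sum_i (m_ s i ^+ 2).1.
Proof. by rewrite -mN_sqr_fst mulr_gt0 ?mN_gt0. Qed.

Lemma mulmN_inj s : injective ( *%R (mN s)).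
Proof.
move=> [b1 b2] [c1 c2] [] /= e1 e2; congr pair.
  exact: (mulfI (lt0r_neq0 (mN_gt0 s)) e1).
exact: (mulfI (lt0r_neq0 (mN2_gt0 s)) e2).
Qed.

(** Passes between the square-root form of the aggregated situation and its
    additive form in squared coordinates. *)
Lemma m_sqr_eqE s s' t i :
  (m_ t i = isqrt (m_ s i ^+ 2 + m_ s' i ^+ 2)) <->
  (m_ t i ^+ 2 = m_ s i ^+ 2 + m_ s' i ^+ 2).
Proof.
have /andP[s0 s1] := m_sqr_bounds s i; have /andP[s'0 s'1] := m_sqr_bounds s' i.
have t0 := orders_ge0 t i; have t1 := lo_le_hi (orders t i).
split=> [->|<-]; first by apply: isqrtK => /=; move: s0 s1 s'0 s'1 => /=; lra.
by rewrite sqr_isqrt //=; exact: le_trans t1.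
Qed.

Lemma situation_of_squares (a : R) x y :
  0 < a -> (forall i, 0 <= x i <= y i) -> 0 < \sum_i x i ->
  (forall i, x i * Num.sqrt (\sum_k y k) <= y i * Num.sqrt (\sum_k x k)) ->
  exists2 s : IS R n, cost s = a & forall i, m_ s i ^+ 2 = (x i, y i).
Proof.
move=> a0 xy X0 hxy.
have le_sqrt i : Num.sqrt (x i) <= Num.sqrt (y i).
  by have /andP[_ h] := xy i; exact: ler_wsqrtr.
pose s := @Situation R n a (fun i => CItv (le_sqrt i)) a0 (fun i => sqrtr_ge0 (x i)).
have ms i : m_ s i ^+ 2 = (x i, y i).
  by have /andP[x0 h] := xy i; rewrite -[RHS]isqrtK //= (le_trans x0).
have mNs : mN s = (Num.sqrt (\sum_i x i), Num.sqrt (\sum_i y i)).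
  by rewrite /mN (eq_bigr _ (fun i _ => ms i)) sum_pair.
have ms1 i : (m_ s i).1 ^+ 2 = x i by rewrite -[x i]/((x i, y i).1) -ms.
have ms2 i : (m_ s i).2 ^+ 2 = y i by rewrite -[y i]/((x i, y i).2) -ms.
have s0 : 0 < (mN s).1 by rewrite mNs sqrtr_gt0.
have sle i : (m_ s i).1 ^+ 2 * (mN s).2 <= (m_ s i).2 ^+ 2 * (mN s).1.
  by rewrite ms1 ms2 mNs.
by exists (MkIS s0 sle).
Qed.

(** * Narrow situations *)

(** The bounds are [2] and [2 ^ 2], so that [sqrt (Y / X) <= 2 <= y_i / x_i];
    they are written without division to allow inactive agents. *)
Definition narrow s : Prop :=
  forall i, 2 * (m_ s i ^+ 2).1 <= (m_ s i ^+ 2).2 <= 4 * (m_ s i ^+ 2).1.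

(** Narrowness is a condition on each agent separately, unlike membership in
    the family, which couples the agents through the sums; this is what makes
    it possible to take parts and to add situations. *)
Lemma narrow_situation (a : R) x y :
  0 < a -> (forall i, 0 <= x i) -> (forall i, 2 * x i <= y i <= 4 * x i) ->
  0 < \sum_i x i ->
  exists2 s : IS R n, cost s = a & forall i, m_ s i ^+ 2 = (x i, y i).
Proof.
move=> a0 x0 xy X0; apply: situation_of_squares => // i.
  by have := x0 i; have := xy i; lra.
have leY : Num.sqrt (\sum_k y k) <= 2 * Num.sqrt (\sum_k x k).
  rewrite -[2]ger0_norm // -sqrtr_sqr -sqrtrM ?sqr_ge0 // ler_wsqrtr //.
  by rewrite mulr_sumr ler_sum // => k _; have := xy k; lra.
have /andP[h _] := xy i.
apply: (le_trans (ler_wpM2l (x0 i) leY)).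
by rewrite mulrA [x i * 2]mulrC ler_wpM2r ?sqrtr_ge0.
Qed.

(** The active agent [i] keeps the lower endpoint of [m_N] positive. *)
Lemma narrow_restrict s (A : pred 'I_n) i :
  narrow s -> A i -> 0 < (m_ s i ^+ 2).1 ->
  exists2 t : IS R n, cost t = cost s &
    forall k, m_ t k ^+ 2 = if A k then m_ s k ^+ 2 else 0.
Proof.
move=> ns Ai xi0.
pose r k := if A k then m_ s k ^+ 2 else 0.
have r0 k : 0 <= (r k).1.
  by rewrite /r; case: ifP => // _; have /andP[] := m_sqr_bounds s k.
have [||||t ct mt] := @narrow_situation (cost s) (fun k => (r k).1) (fun k => (r k).2).
- exact: cost_gt0.
- exact: r0.
- by move=> k; rewrite /r; case: ifP => _; [exact: ns|rewrite /= !mulr0 lexx].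
- rewrite (bigD1 i) //= ltr_pwDl ?sumr_ge0 //.
  by rewrite /r Ai.
by exists t => // k; rewrite mt -surjective_pairing.
Qed.

(** * Rules as additive maps *)

(** The quantity in which TBA is plain additivity. *)
Definition weighted Psi s j : R * R := mN s * endpoints (Psi s j).

Lemma sum_weightedP Psi :
  is_allocation_rule Psi <->
  forall s, \sum_j weighted Psi s j = iscale (2 * cost s) (\sum_j m_ s j ^+ 2).
Proof.
have E s : mN s * iscale (2 * cost s) (mN s) =
           iscale (2 * cost s) (\sum_j m_ s j ^+ 2).
  by rewrite !iscaleE mulrCA -expr2 mN_sqr.
split=> H s; first by rewrite -mulr_sumr H E.
by apply: (@mulmN_inj s); rewrite /= mulr_sumr [LHS]H -E.
Qed.

Lemma weightedDP Psi :
  TBA Psi <->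
  forall s s' t, cost s' = cost s -> cost t = cost s ->
    (forall i, m_ t i ^+ 2 = m_ s i ^+ 2 + m_ s' i ^+ 2) ->
    forall j, weighted Psi t j = weighted Psi s j + weighted Psi s' j.
Proof.
split=> H s s' t cs' ct mt j.
  rewrite /weighted -(H s s' t) // => [|i]; last exact/m_sqr_eqE.
  by rewrite /mN (eq_bigr _ (fun i _ => mt i)).
have mt2 i : m_ t i ^+ 2 = m_ s i ^+ 2 + m_ s' i ^+ 2 by exact/m_sqr_eqE.
by rewrite -(eq_bigr _ (fun i _ => mt2 i)); exact: H.
Qed.

Lemma IAE_weighted Psi s j : IAE Psi -> m_ s j ^+ 2 = 0 -> weighted Psi s j = 0.
Proof.
move=> iae mj; rewrite /weighted iae; first exact: mulr0.
have h0 := orders_ge0 s j; have h := lo_le_hi (orders s j).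
rewrite -[LHS]sqr_isqrt ?mj //=; first by rewrite /isqrt /= sqrtr0.
exact: le_trans h.
Qed.

Lemma weighted_SOC s j :
  weighted (@SOC R n) s j = iscale (2 * cost s) (m_ s j ^+ 2).
Proof.
rewrite /weighted [RHS]surjective_pairing.
by congr pair; rewrite mulrC divfK // lt0r_neq0 ?mN_gt0 ?mN2_gt0.
Qed.

Lemma SOC_rule :
  [/\ is_allocation_rule (@SOC R n), IAE (@SOC R n) & TBA (@SOC R n)].
Proof.
split.
- apply/sum_weightedP => s; rewrite iscaleE mulr_sumr.
  by apply: eq_bigr => j _; exact: weighted_SOC.
- move=> s j mj; apply: (@mulmN_inj s); rewrite [LHS]weighted_SOC mj.
  by rewrite expr2 /iscale /= !mulr0.
apply/weightedDP => s s' t cs' ct mt j.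
by rewrite !weighted_SOC !iscaleE cs' ct mt mulrDr.
Qed.

(** * Uniqueness *)

Section Uniqueness.
Variable Psi : IS R n -> 'I_n -> citv R.
Hypotheses (alloc : is_allocation_rule Psi) (iae : IAE Psi) (tba : TBA Psi).

Lemma weighted_single s j :
  (forall i, i != j -> m_ s i ^+ 2 = 0) ->
  weighted Psi s j = iscale (2 * cost s) (m_ s j ^+ 2).
Proof.
move=> m0; have := (sum_weightedP Psi).1 alloc s.
have w0 i : i != j -> weighted Psi s i = 0 by move/m0; exact: IAE_weighted.
by rewrite !(bigD1 (P := xpredT) j) //= (big1 _ _ _ w0) (big1 _ _ _ m0) !addr0.
Qed.

(** Split [s] into agent [j] alone and the remaining agents; both parts are
    again situations of the family, unless one of them is zero, and then the
    value follows from IAE or from [weighted_single]. *)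
Lemma weighted_narrow s j :
  narrow s -> weighted Psi s j = iscale (2 * cost s) (m_ s j ^+ 2).
Proof.
move=> ns.
have m0 i : ~~ (0 < (m_ s i ^+ 2).1) -> m_ s i ^+ 2 = 0.
  move=> xi; rewrite [LHS]surjective_pairing; congr pair.
    by have := m_sqr_bounds s i; lra.
  by have := m_sqr_bounds s i; have := ns i; lra.
have [xj|xj] := boolP (0 < (m_ s j ^+ 2).1); last first.
  by have mj := m0 j xj; rewrite (IAE_weighted iae mj) iscaleE mj mulr0.
have [/existsP[k /andP[kj xk]]|none] :=
  boolP [exists k, (k != j) && (0 < (m_ s k ^+ 2).1)]; last first.
  apply: weighted_single => i ij; apply: m0; apply: contra none => xi.
  by apply/existsP; exists i; rewrite ij.
have [t ct mt] := @narrow_restrict s (pred1 j) j ns (eqxx j) xj.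
have [u cu mu] := @narrow_restrict s (predC1 j) k ns kj xk.
have mE i : m_ s i ^+ 2 = m_ t i ^+ 2 + m_ u i ^+ 2.
  by rewrite mt mu /=; case: (i == j); rewrite ?addr0 ?add0r.
have uj : m_ u j ^+ 2 = 0 by rewrite mu /= eqxx.
have ti i : i != j -> m_ t i ^+ 2 = 0 by move=> ij; rewrite mt /= (negPf ij).
have cut : cost u = cost t by rewrite cu.
rewrite ((weightedDP Psi).1 tba t u s cut (esym ct) mE).
by rewrite (IAE_weighted iae uj) (weighted_single ti) mE uj !addr0 ct.
Qed.

(** Write [s] as a difference of two narrow situations, where the value is
    known. *)
Lemma weighted_unique s j :
  weighted Psi s j = iscale (2 * cost s) (m_ s j ^+ 2).
Proof.
pose x i := (m_ s i ^+ 2).1; pose y i := (m_ s i ^+ 2).2.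
have bnd i : 0 <= x i <= y i := m_sqr_bounds s i.
have y0 i : 0 <= y i by have := bnd i; lra.
(* Narrowness of the sum with squares (L, 3 L) needs 2 x_i <= L and y_i <= L;
   both follow from 2 y_i <= L. *)
pose L := 2 * \sum_i y i.
have yL i : 2 * y i <= L.
  by rewrite ler_pM2l // (bigD1 i) //= lerDl sumr_ge0.
have L0 : 0 < L.
  rewrite mulr_gt0 //; apply: (lt_le_trans (sum_lo_gt0 s)).
  by apply: ler_sum => i _; have /andP[] := bnd i.
have sum_gt0 (f : 'I_n -> R) : (forall i, 0 < f i) -> 0 < \sum_i f i.
  move=> f0; rewrite (bigD1 j) //= ltr_pwDl ?sumr_ge0 // => i _; exact: ltW.
have [||||u cu mu] := @narrow_situation (cost s) (fun=> L) (fun=> 3 * L).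
- exact: cost_gt0.
- by move=> _; exact: ltW.
- by move=> _; lra.
- by apply: sum_gt0 => _.
have [||||t ct mt] :=
  @narrow_situation (cost s) (fun i => x i + L) (fun i => y i + 3 * L).
- exact: cost_gt0.
- by move=> i; have := bnd i; lra.
- by move=> i; have := bnd i; have := yL i; lra.
- by apply: sum_gt0 => i; have := bnd i; lra.
have nu : narrow u by move=> i; rewrite mu /=; lra.
have nt : narrow t by move=> i; rewrite mt /=; have := bnd i; have := yL i; lra.
have mE i : m_ t i ^+ 2 = m_ s i ^+ 2 + m_ u i ^+ 2.
  by rewrite mt mu [in RHS](surjective_pairing (m_ s i ^+ 2)).
have := (weightedDP Psi).1 tba s u t cu ct mE j.
rewrite (weighted_narrow _ nt) (weighted_narrow _ nu) cu ct mE !iscaleE mulrDr.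
by move/addIr.
Qed.

Lemma rule_eq_SOC : Psi = @SOC R n.
Proof.
apply/funext => s; apply/funext => j.
apply: endpoints_inj; apply: (@mulmN_inj s).
by rewrite [LHS]weighted_unique -weighted_SOC.
Qed.

End Uniqueness.

End Situations.

Theorem theorem3p1 (R : realType) (n : nat) (n_gt0 : (0 < n)%N) :
  (exists! Psi : IS R n -> 'I_n -> citv R,
     [/\ is_allocation_rule Psi, IAE Psi & TBA Psi])
  /\ [/\ is_allocation_rule (@SOC R n), IAE (@SOC R n) & TBA (@SOC R n)].
Proof.
split; last exact: SOC_rule.
exists (@SOC R n); split; first exact: SOC_rule.
by move=> Psi [alloc iae tba]; rewrite (rule_eq_SOC alloc iae tba).
Qed.
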